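(* Let $T$ be a tree of order $n \geq 4$ with $\Delta(T) \geq 3$. Then $$\mathrm{hc}(T) = (n-1)(n-1-\zeta(T)) + \zeta'(T) - 2\mathcal{L}_W(T)$$ holds if and only if there exists an ordering $x_0, x_1, \ldots, x_{n-1}$ of the vertices of $T$, with $\mathcal{L}(x_0) = 0$ and $\mathcal{L}(x_{n-1}) = 1$ when $|W(T)| = 1$, and $\mathcal{L}(x_0) = \mathcal{L}(x_{n-1}) = 0$ when $|W(T)| = 2$, such that for all $0 \leq i < j \leq n-1$, $$D(x_i,x_j) \geq \sum_{t=i}^{j-1}\big(\mathcal{L}(x_t) + \mathcal{L}(x_{t+1})\big) - (j-i)(n-1-\zeta(T)) + (n-1).$$ Moreover, under this condition the mapping $h$ defined by $h(x_0) = 0$ and $h(x_{i+1}) = h(x_i) + n - 1 - \zeta(T) - \mathcal{L}(x_i) - \mathcal{L}(x_{i+1})$ for $0 \leq i \leq n-2$ is an optimal hamiltonian coloring of $T$ (i.e. a hamiltonian coloring of span $\mathrm{hc}(T)$).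
   Context: For a connected graph $G$ of order $n$, the detour distance $D(u,v)$ is the length of a longest $u$–$v$ path (in a tree it equals the ordinary distance). A hamiltonian coloring of $G$ is a map $h: V(G) \to \{0,1,2,\ldots\}$ such that $D(u,v) + |h(u)-h(v)| \geq n-1$ for all distinct $u,v$. Its span is $\max\{|h(u)-h(v)|\}$, and $\mathrm{hc}(G)$ is the minimum span over all hamiltonian colorings. For a tree $T$ and $v \in V(T)$ let $w_T(v) = \sum_{u} d(u,v)$; a weight center is a vertex minimizing $w_T$, and $W(T)$ is the set of weight centers (one vertex $w$, or two adjacent vertices $w,w'$). $\zeta(T) = 0$ if $|W(T)| = 1$, $\zeta(T) = 1$ if $|W(T)| = 2$, $\zeta'(T) = 1-\zeta(T)$. $\mathcal{L}(u) = \min\{D(u,x) : x \in W(T)\}$ and $\mathcal{L}_W(T) = \sum_{u \in V(T)} \mathcal{L}(u)$. *)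

(* Defs.v *)
From mathcomp Require Import all_boot all_order all_algebra.
From mathcomp Require Import boolp.

Set Implicit Arguments.
Unset Strict Implicit.
Unset Printing Implicit Defensive.

Section Graphs.
Variables (T : finType) (e : rel T).

Definition is_tree : Prop :=
  [/\ symmetric e, irreflexive e, forall u v, connect e u v
    & forall c : seq T, ucycle e c -> size c < 3].

Definition max_degree : nat := \max_(v : T) #|[set u | e v u]|.

(* A u-v path (no repeated vertex) with exactly k edges. *)
Definition upath (u v : T) (k : nat) : bool :=
  [exists p : k.-tuple T, [&& path e u p, last u p == v & uniq (u :: p)]].

(* A path has at most #|T| - 1 edges, so ranging over k < #|T| is no loss. *)
Definition detour (u v : T) : nat := \max_(k < #|T| | upath u v k) k.

(* The default #|T| is only returned when u and v are not connected. *)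
Definition dist (u v : T) : nat :=
  \big[minn/#|T|]_(k < #|T| | upath u v k) (k : nat).

Definition hamiltonian_coloring (h : T -> nat) : Prop :=
  forall u v, u != v -> #|T| - 1 <= detour u v + `|h u - h v|.

Definition coloring_span (h : T -> nat) : nat :=
  \max_(u : T) \max_(v : T) `|h u - h v|.

Lemma ex_hamiltonian_span :
  exists k : nat,
    `[< exists2 h, hamiltonian_coloring h & coloring_span h = k >].
Proof.
pose h (u : T) := #|T| * enum_rank u.
exists (coloring_span h); apply/asboolP; exists h => // u v neq_uv.
apply: leq_trans (leq_addl _ _); apply: leq_trans (leq_subr _ _) _.
have: enum_rank u != enum_rank v :> nat.
  by apply: contra neq_uv => /eqP/val_inj/enum_rank_inj ->.
rewrite /h -distn_eq0 -lt0n => d_gt0.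
by rewrite !PoszM -GRing.mulrBr abszM leq_pmulr.
Qed.

Definition hc : nat := ex_minn ex_hamiltonian_span.

Definition optimal_coloring (h : T -> nat) : Prop :=
  hamiltonian_coloring h /\ coloring_span h = hc.

Definition weight (v : T) : nat := \sum_(u : T) dist u v.

Definition weight_centers : {set T} :=
  [set v | [forall u, weight v <= weight u]].

Definition zeta : nat := if #|weight_centers| == 2 then 1 else 0.
Definition zeta' : nat := 1 - zeta.

(* weight_centers is nonempty for nonempty T and detour < #|T|, so the default
   #|T| does not affect the minimum. *)
Definition level (u : T) : nat :=
  \big[minn/#|T|]_(x in weight_centers) detour u x.

Definition total_level : nat := \sum_(u : T) level u.

Local Open Scope ring_scope.

(* Orderings are x 0, ..., x (#|T| - 1); the values of x beyond are unused. *)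
Definition is_ordering (x : nat -> T) : Prop :=
  perm_eq (mkseq x #|T|) (enum T).

Definition endpoint_condition (x : nat -> T) : Prop :=
  (#|weight_centers| = 1%N ->
     level (x 0%N) = 0%N /\ level (x (#|T| - 1)%N) = 1%N) /\
  (#|weight_centers| = 2%N ->
     level (x 0%N) = 0%N /\ level (x (#|T| - 1)%N) = 0%N).

Definition detour_condition (x : nat -> T) : Prop :=
  forall i j : nat, (i < j < #|T|)%N ->
    \sum_(i <= t < j) ((level (x t))%:Z + (level (x t.+1))%:Z)
      - (j%:Z - i%:Z) * (#|T|%:Z - 1 - zeta%:Z) + (#|T|%:Z - 1)
    <= (detour (x i) (x j))%:Z.

Definition good_ordering (x : nat -> T) : Prop :=
  [/\ is_ordering x, endpoint_condition x & detour_condition x].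

Definition induced_coloring (x : nat -> T) (h : T -> nat) : Prop :=
  h (x 0%N) = 0%N /\
  forall i : nat, (i.+1 < #|T|)%N ->
    (h (x i.+1))%:Z = (h (x i))%:Z + #|T|%:Z - 1 - zeta%:Z
                        - (level (x i))%:Z - (level (x i.+1))%:Z.

End Graphs.

(* Main.v *)
Require Import Defs.
From mathcomp Require Import all_boot all_order all_algebra zify.

(** Paths in a tree are unique, so the detour distance is a metric, and weights
    are strictly convex along paths; hence two weight centers are adjacent and
    [detour u v <= level u + level v + zeta].  Listing the vertices by increasing
    color, each step of a hamiltonian coloring is at least
    [n - 1 - zeta - level (x i) - level (x i.+1)].  Summing the steps gives the
    lower bound on [hc], where the two ends contribute [zeta'] at least; equality
    forces every step to be tight, and tightness turns the coloring inequalities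
    into the detour condition, and conversely. *)

(** * Unique paths and the detour metric of a tree *)

Section TreePaths.

Variables (T : finType) (e : rel T).
Hypothesis tree_e : is_tree e.

Local Notation d := (detour e).

Lemma tree_upath_unique u p q :
    path e u p -> uniq (u :: p) -> path e u q -> uniq (u :: q) ->
  last u p = last u q -> p = q.
Proof.
case: tree_e => e_sym _ _ e_acyclic.
elim: p u q => [|a p IHp] u [|b q] //=.
- by move=> _ _ _ /andP[uNq _] Du; rewrite Du mem_last in uNq.
- by move=> _ /andP[uNp _] _ _ Du; rewrite -Du mem_last in uNp.
move=> /andP[e_ua e_p] /andP[uNp Up] /andP[e_ub e_q] /andP[uNq Uq] Dlast.
have [Dab | neq_ab] := eqVneq a b.
  by rewrite -Dab in e_q Uq Dlast *; rewrite (IHp a q).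
(* Going from a to the common end, then back to b, gives a walk avoiding u;
   shortening it and closing it at u yields a cycle. *)
pose r := p ++ rev (belast b q).
have e_r : path e a r.
  rewrite cat_path e_p Dlast rev_path.
  by rewrite (eq_path (e' := e)) // => x y; apply: e_sym.
have last_r : last a r = b.
  by rewrite last_cat Dlast; case: (q) => //= c q'; rewrite rev_cons last_rcons.
have uNr : u \notin a :: r.
  apply: contra uNp; rewrite -cat_cons mem_cat => /orP[//|].
  rewrite mem_rev => /mem_belast.
  by rewrite (negPf uNq).
case/shortenP: e_r last_r => s e_s Us sub_s last_s.
(* An edge traversed both ways is a [ucycle] of size 2, so acyclicity bounds the size by 2; this
   forces [s] to be empty and hence [a = b]. *)
suff: size [:: u, a & s] < 3.
  by case: (s) last_s => //= Dab; rewrite Dab eqxx in neq_ab.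
apply: e_acyclic; apply/andP; split.
  by rewrite /= e_ua rcons_path e_s last_s e_sym.
rewrite cons_uniq Us andbT; apply: contra uNr.
by rewrite !inE => /orP[->//|/sub_s->]; rewrite orbT.
Qed.

Lemma upathP u v k :
  reflect (exists p, [/\ path e u p, last u p = v, uniq (u :: p) & size p = k])
          (upath e u v k).
Proof.
apply: (iffP existsP) => [[p /and3P[e_p /eqP last_p Up]] | [p [e_p last_p Up sz_p]]].
  by exists p; rewrite size_tuple.
have sz_p' : size p == k by apply/eqP.
by exists (Tuple sz_p'); rewrite e_p last_p eqxx Up.
Qed.

Lemma size_uniq_cons_lt (u : T) p : uniq (u :: p) -> size p < #|T|.
Proof.
by move=> Up; rewrite cardE -[_.+1]/(size (u :: p)) uniq_leq_size // => x; rewrite mem_enum.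
Qed.

Lemma tree_upath_size u p k :
  path e u p -> uniq (u :: p) -> upath e u (last u p) k -> k = size p.
Proof.
move=> e_p Up /upathP[q [e_q last_q Uq <-]]; congr size.
exact: (tree_upath_unique u).
Qed.

Lemma tree_detourE u p : path e u p -> uniq (u :: p) -> d u (last u p) = size p.
Proof.
move=> e_p Up; apply/eqP; rewrite eqn_leq; apply/andP; split.
  by apply/bigmax_leqP => k /(tree_upath_size u p k e_p Up)->.
rewrite -[size p]/(nat_of_ord (Ordinal (size_uniq_cons_lt u p Up))).
by apply: leq_bigmax_cond; apply/upathP; exists p.
Qed.

Lemma tree_upath_exists u v : exists p, [/\ path e u p, last u p = v & uniq (u :: p)].
Proof.
case: tree_e => _ _ e_conn _.
have /connectP[p e_p ->] := e_conn u v.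
by case/shortenP: e_p => q e_q Uq _; exists q.
Qed.

Lemma tree_distE u v : dist e u v = d u v.
Proof.
have [p [e_p <- Up]] := tree_upath_exists u v.
rewrite (tree_detourE u p) // /dist -minEnat.
have up : upath e u (last u p) (Ordinal (size_uniq_cons_lt u p Up)).
  by apply/upathP; exists p.
(* The default [#|T|] exceeds every admissible [k], so the minimum is attained by some path. *)
have [k _ |k Pk ->] :=
  @Order.TotalTheory.eq_bigmin _ _ _ #|T| (Ordinal (size_uniq_cons_lt u p Up))
    (fun k => upath e u (last u p) k) (fun k : 'I_#|T| => k : nat) up.
  exact: ltnW.
exact: tree_upath_size Pk.
Qed.

(** Shortening a walk yields a path with the same ends, and in a tree this path is the only one. *)
Lemma tree_detour_le_walk u p : path e u p -> d u (last u p) <= size p.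
Proof.
move=> e_p; case/shortenP: (e_p) => q e_q Uq sub_q.
by rewrite tree_detourE // uniq_leq_size //; case/andP: Uq.
Qed.

Lemma tree_detour_triangle w u v : d u v <= d u w + d w v.
Proof.
have [p [e_p last_p Up]] := tree_upath_exists u w.
have [q [e_q last_q Uq]] := tree_upath_exists w v.
have -> : d u w = size p by rewrite -last_p tree_detourE.
have -> : d w v = size q by rewrite -last_q tree_detourE.
rewrite -size_cat -last_q -last_p -last_cat tree_detour_le_walk //.
by rewrite cat_path e_p last_p.
Qed.

Lemma tree_detourC u v : d u v = d v u.
Proof.
case: (tree_e) => e_sym _ _ _.
suff le_d a b : d a b <= d b a by apply/eqP; rewrite eqn_leq !le_d.
move: a b => {}u {}v.
have [p [e_p last_p Up]] := tree_upath_exists v u.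
have -> : d v u = size p by rewrite -last_p tree_detourE.
have e_r : path e u (rev (belast v p)).
  by rewrite -last_p rev_path (eq_path (e' := e)) // => x y; apply: e_sym.
have := tree_detour_le_walk u _ e_r; rewrite size_rev size_belast.
suff -> : last u (rev (belast v p)) = v by [].
by case: (p) last_p => //= c p' _; rewrite rev_cons last_rcons.
Qed.

Lemma detour_lt_card u v : 0 < #|T| -> d u v < #|T|.
Proof.
move=> n_gt0; rewrite -(prednK n_gt0) ltnS; apply/bigmax_leqP => k _.
by rewrite -ltnS prednK.
Qed.

Lemma tree_detour_eq0 u v : (d u v == 0) = (u == v).
Proof.
have [p [e_p last_p Up]] := tree_upath_exists u v.
rewrite -last_p tree_detourE //; case: p Up {e_p last_p} => [|a p] /= => [_|/andP[uNp _]].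
  by rewrite !eqxx.
by apply/esym/negbTE; apply: contraNneq uNp => {1}->; rewrite mem_last.
Qed.

Lemma neq_edge u v : e u v -> u != v.
Proof.
by case: tree_e => _ e_irr _ _ e_uv; apply: contraTneq e_uv => ->; rewrite e_irr.
Qed.

Lemma tree_detour_edge u v : e u v -> d u v = 1.
Proof.
move=> e_uv.
by rewrite -[d u v]/(d u (last u [:: v])) tree_detourE //= ?e_uv // inE neq_edge.
Qed.

(** Prepending [a] keeps the path free of repetitions. For empty [p], [head b p] is [b] itself, so
    every neighbor [a] of [b] qualifies. *)
Lemma tree_detour_away a b p :
    e a b -> path e b p -> uniq (b :: p) -> a != head b p ->
  d a (last b p) = (size p).+1.
Proof.
case: tree_e => e_sym _ _ e_acyclic e_ab e_p Up aNx.
rewrite -[last b p]/(last a (b :: p)) tree_detourE //=; first by rewrite e_ab.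
move: (Up) => /= ->; rewrite andbT inE negb_or.
rewrite neq_edge //=.
(* If [a] met the path after its head, the edge from [a] to [b] would close a cycle of size at least
   3. *)
apply/negP => a_p; case/splitPr: a_p e_p Up aNx => [[|x p1] p2].
  by rewrite /= eqxx.
rewrite cat_path => /andP[e_xp1 /= /andP[e_xa _]] U_p _.
suff: size (b :: rcons (x :: p1) a) < 3 by rewrite /= size_rcons; lia.
apply: e_acyclic; apply/andP; split.
  rewrite -[cycle _ _]/(path e b (rcons (rcons (x :: p1) a) b)).
  by rewrite rcons_path last_rcons e_ab rcons_path e_xp1 e_xa.
have {U_p}: uniq ((b :: rcons (x :: p1) a) ++ p2) by rewrite cat_cons cat_rcons.
by rewrite cat_uniq => /and3P[].
Qed.

(** At most one neighbor of [b] lies towards [u]; any other is one step further from [u] than [b].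
    The term [(u == b).*2] records the strict gain when [u] is [b] itself. *)
Lemma tree_detour_convex u a b c :
    e a b -> e b c -> a != c ->
  2 * d u b + (u == b).*2 <= d u a + d u c.
Proof.
case: (tree_e) => e_sym _ _ _ e_ab e_bc aNc.
rewrite !(tree_detourC u).
have [p [e_p last_p Up]] := tree_upath_exists b u.
have -> : d b u = size p by rewrite -last_p tree_detourE.
have away x : e x b -> x != head b p -> d x u = (size p).+1.
  by move=> e_xb xNp; rewrite -last_p tree_detour_away.
have near x : e x b -> size p <= (d x u).+1.
  move=> e_xb; have := tree_detour_triangle x b u.
  by rewrite (tree_detour_edge b x) 1?e_sym // -{1}last_p tree_detourE.
have e_cb : e c b by rewrite e_sym.
have {last_p} ub : (u == b) = (size p == 0).
  by rewrite eq_sym -tree_detour_eq0 -last_p tree_detourE.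
case: p e_p Up away near ub => [|x p] /= _ _ away near -> /=.
  by rewrite !away // neq_edge.
have [Da|aNx] := eqVneq a x; last by rewrite (away a) //; have := near c e_cb; lia.
rewrite (away c) //; first by have := near a e_ab; lia.
by rewrite -Da eq_sym.
Qed.

(** * Convexity of weights and the weight centers *)

Local Notation w := (weight e).

Lemma tree_weight_convex a b c :
  e a b -> e b c -> a != c -> 2 * w b < w a + w c.
Proof.
move=> e_ab e_bc aNc; rewrite /weight big_distrr -big_split /=.
(* The term for [u = b] is split off because it makes the inequality strict. *)
rewrite (bigD1 b) //= [X in _ < X](bigD1 b) //= -addSn leq_add //.
  by have := tree_detour_convex b a b c e_ab e_bc aNc; rewrite !tree_distE eqxx; lia.
apply: leq_sum => u uNb.
by have := tree_detour_convex u a b c e_ab e_bc aNc; rewrite !tree_distE; lia.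
Qed.

(** Once the weight fails to decrease along one edge, strict convexity makes it rise on every later
    edge of the path. *)
Lemma tree_weight_increasing a b p :
    path e a (b :: p) -> uniq [:: a, b & p] -> w a <= w b -> p != [::] ->
  w b < w (last b p).
Proof.
elim: p a b => // c p IHp a b /= /and3P[e_ab e_bc e_p] Uabcp le_ab _.
have aNc : a != c by move: Uabcp; rewrite /= !inE !negb_or => /andP[/and3P[]].
have lt_bc : w b < w c by have := tree_weight_convex a b c e_ab e_bc aNc; lia.
have [-> // | pN0] := eqVneq p [::].
apply: (ltn_trans (lt_bc)); apply: (IHp b) => //; last exact: ltnW lt_bc.
  by rewrite /= e_bc.
by case/andP: Uabcp.
Qed.

(** On a path of length at least 2 between centers, the first edge cannot decrease the weight, so
    the far end would be heavier than an earlier vertex. *)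
Lemma weight_centers_adjacent a b :
  a \in weight_centers e -> b \in weight_centers e -> a != b -> e a b.
Proof.
rewrite !inE => /forallP min_a /forallP min_b aNb.
have [[|c p] [e_p last_p Up]] := tree_upath_exists a b.
  by rewrite -last_p eqxx in aNb.
have [p0|pN0] := eqVneq p [::].
  by move: last_p e_p; rewrite p0 /= andbT => ->.
have := tree_weight_increasing a c p e_p Up (min_a c) pN0.
by rewrite -[last c p]/(last a (c :: p)) last_p ltnNge min_b.
Qed.

Lemma weight_centers_neq0 : 0 < #|T| -> weight_centers e != set0.
Proof.
case/card_gt0P=> x0 _; apply/set0Pn.
exists [arg min_(v < x0) w v]; rewrite inE.
by case: arg_minnP => // v _ min_v; apply/forallP => u; apply: min_v.
Qed.

(** Three centers would be pairwise adjacent and form a triangle. *)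
Lemma card_weight_centers_le2 : #|weight_centers e| <= 2.
Proof.
case: (tree_e) => _ _ _ e_acyclic; rewrite leqNgt; apply/negP.
case/card_gt2P=> [a [b [c [[Wa Wb Wc] [aNb bNc cNa]]]]].
suff: size [:: a; b; c] < 3 by [].
apply: e_acyclic; rewrite /ucycle /= !inE negb_or aNb bNc (eq_sym a c) cNa.
by rewrite !weight_centers_adjacent.
Qed.

(** * Levels and their relation to the detour distance *)

Lemma level_attained u :
  0 < #|T| -> exists2 x, x \in weight_centers e & level e u = d u x.
Proof.
move=> n_gt0; have /set0Pn[x0 Wx0] := weight_centers_neq0 n_gt0.
rewrite /level -minEnat.
have [k _ |k Wk ->] :=
  @Order.TotalTheory.eq_bigmin _ _ _ #|T| x0 (mem (weight_centers e)) (d u) Wx0.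
  by rewrite leEnat ltnW // detour_lt_card.
by exists k.
Qed.

(** Going through a nearest center of each vertex costs both levels plus the distance between these
    centers. They are equal or adjacent, the latter only when [zeta] is 1. *)
Lemma detour_le_levels u v : d u v <= level e u + level e v + zeta e.
Proof.
have n_gt0 : 0 < #|T| by apply/card_gt0P; exists u.
have [a Wa ->] := level_attained u n_gt0.
have [b Wb ->] := level_attained v n_gt0.
have := tree_detour_triangle a u v; have := tree_detour_triangle b a v.
rewrite (tree_detourC b v).
suff: d a b <= zeta e by lia.
have [-> | aNb] := eqVneq a b; first by move: (tree_detour_eq0 b b); rewrite eqxx => /eqP->.
rewrite tree_detour_edge; last exact: weight_centers_adjacent.
rewrite /zeta eqn_leq card_weight_centers_le2 /=.
by have -> : 1 < #|weight_centers e| by apply/card_gt1P; exists a, b.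
Qed.

Lemma level_sum_ge u v : u != v -> zeta' e <= level e u + level e v.
Proof.
move=> uNv; rewrite /zeta'.
have : d u v != 0 by rewrite tree_detour_eq0.
by have := detour_le_levels u v; lia.
Qed.

End TreePaths.

(** * Vertex orderings and colorings monotone along them *)

Section Orderings.

Variables (T : finType) (x : nat -> T).
Hypothesis ord_x : is_ordering x.

Local Notation n := #|T|.

Lemma ordering_inj i j : i < n -> j < n -> x i = x j -> i = j.
Proof.
by apply/mkseq_uniqP: i j; rewrite (perm_uniq ord_x) enum_uniq.
Qed.

Lemma ordering_surj v : exists2 i, i < n & x i = v.
Proof.
have: v \in mkseq x n by rewrite (perm_mem ord_x) mem_enum.
by case/mapP=> i; rewrite mem_iota => lt_i ->; exists i.
Qed.

Lemma ordering_sum (F : T -> nat) : \sum_(0 <= i < n) F (x i) = \sum_v F v.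
Proof.
by rewrite -[RHS]big_enum -(perm_big _ ord_x) big_map /index_iota subn0.
Qed.

(** Serves to swap the two ends when the end of level 1 comes first. *)
Lemma is_ordering_rev : is_ordering (fun i => x (n - 1 - i)).
Proof.
rewrite /is_ordering; set y := mkseq _ _.
suff -> : y = rev (mkseq x n) by rewrite perm_rev.
apply: (@eq_from_nth _ (x 0)) => [|i]; first by rewrite size_rev !size_mkseq.
rewrite size_mkseq => lt_i; rewrite nth_rev ?size_mkseq // !nth_mkseq; try lia.
by congr x; lia.
Qed.

Definition nondecreasing_along (h : T -> nat) :=
  forall i j, i <= j < n -> h (x i) <= h (x j).

Lemma span_nondecreasing h :
  0 < n -> nondecreasing_along h -> coloring_span h = h (x (n - 1)) - h (x 0).
Proof.
move=> n_gt0 mono_h.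
have le_h v : h (x 0) <= h v <= h (x (n - 1)).
  by have [i lt_i <-] := ordering_surj v; rewrite !mono_h; lia.
apply/eqP; rewrite eqn_leq; apply/andP; split.
  apply/bigmax_leqP => u _; apply/bigmax_leqP => v _.
  by have := le_h u; have := le_h v; lia.
apply: (bigmax_sup (x (n - 1))) => //; apply: (bigmax_sup (x 0)) => //.
by have := le_h (x 0); lia.
Qed.

End Orderings.

Lemma exists_nondecreasing_ordering (T : finType) (h : T -> nat) :
  0 < #|T| -> exists2 x, is_ordering x & nondecreasing_along T x h.
Proof.
case/card_gt0P=> x0 _; pose leh u v := h u <= h v.
pose s := sort leh (enum T).
have sz_s : size s = #|T| by rewrite size_sort -cardE.
exists (nth x0 s) => [|i j /andP[le_ij lt_j]].
  by rewrite /is_ordering -sz_s mkseq_nth perm_sort.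
apply: (sorted_leq_nth (leT := leh)) => //.
- by move=> u v w; apply: leq_trans.
- by move=> u; apply: leqnn.
- by apply: sort_sorted => u v; apply: leq_total.
- by rewrite inE sz_s; lia.
by rewrite inE sz_s.
Qed.

(** * The lower bound on the span *)

Section TreeColorings.

Variables (T : finType) (e : rel T).
Hypothesis (tree_e : is_tree e) (T_gt0 : 0 < #|T|).

Local Notation n := #|T|.
Local Notation d := (detour e).
Local Notation L := (level e).

Local Open Scope ring_scope.

Definition hc_bound : int :=
  (n%:Z - 1) * (n%:Z - 1 - (zeta e)%:Z) + (zeta' e)%:Z - 2 * (total_level e)%:Z.

(* The value forced on h (x j) - h (x i) when every step h (x t.+1) - h (x t)
   is as small as the bound d u v <= L u + L v + zeta permits. *)
Definition tight_gap (x : nat -> T) (i j : nat) : int :=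
  (j%:Z - i%:Z) * (n%:Z - 1 - (zeta e)%:Z)
    - \sum_(i <= t < j) ((L (x t))%:Z + (L (x t.+1))%:Z).

Lemma tight_gap_refl x i : tight_gap x i i = 0.
Proof. by rewrite /tight_gap big_geq //; lia. Qed.

Lemma tight_gapS x i j : (i <= j)%N ->
  tight_gap x i j.+1 = tight_gap x i j + n%:Z - 1 - (zeta e)%:Z
                         - (L (x j))%:Z - (L (x j.+1))%:Z.
Proof.
move=> le_ij; rewrite /tight_gap big_nat_recr //=.
by move: (\sum_(_ <= _ < _) _) => S; lia.
Qed.

Lemma tight_gapD x i j k : (i <= j)%N -> (j <= k)%N ->
  tight_gap x i k = tight_gap x i j + tight_gap x j k.
Proof.
move=> le_ij le_jk; rewrite /tight_gap (@big_cat_nat _ _ _ j) //=.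
by move: (\sum_(i <= _ < j) _) (\sum_(j <= _ < k) _) => S S'; lia.
Qed.

Lemma tight_gap_total x : is_ordering x ->
  tight_gap x 0 (n - 1)
    = hc_bound - (zeta' e)%:Z + (L (x 0%N))%:Z + (L (x (n - 1)%N))%:Z.
Proof.
move=> ord_x.
(* Each level is counted twice in the sum over consecutive pairs, except those of the two ends. *)
have sumE m : \sum_(0 <= t < m) ((L (x t))%:Z + (L (x t.+1))%:Z)
    = 2 * (\sum_(0 <= t < m.+1) L (x t))%N%:Z - (L (x 0%N))%:Z - (L (x m))%:Z.
  elim: m => [|m IHm]; first by rewrite [LHS]big_geq // big_nat1; lia.
  rewrite [LHS]big_nat_recr //= IHm [in RHS]big_nat_recr //=.
  by move: (\sum_(_ <= _ < _) _)%N => S; lia.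
rewrite /tight_gap sumE.
have -> : (n - 1).+1 = n by lia.
have -> : (n - 1)%N%:Z - 0%N%:Z = n%:Z - 1 by lia.
rewrite (ordering_sum _ _ ord_x) /hc_bound /total_level.
by move: (\sum_v _)%N => S; lia.
Qed.

(** For consecutive vertices, the coloring inequality and [detour_le_levels] bound the color
    increase below by one tight step; monotonicity removes the absolute value. *)
Lemma tight_gap_le x h i j :
    hamiltonian_coloring e h -> is_ordering x -> nondecreasing_along T x h ->
  (i <= j < n)%N -> tight_gap x i j <= (h (x j))%:Z - (h (x i))%:Z.
Proof.
move=> ham_h ord_x mono_h /andP[]; elim: j => [|j IHj] le_ij lt_j.
  by move: le_ij; rewrite leqn0 => /eqP->; rewrite tight_gap_refl; lia.
move: le_ij; rewrite leq_eqVlt => /predU1P[->|]; first by rewrite tight_gap_refl; lia.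
rewrite ltnS => le_ij; rewrite tight_gapS //.
have := IHj le_ij (ltnW lt_j).
have neq_x : x j != x j.+1.
  by apply/eqP => /(ordering_inj _ _ ord_x _ _ (ltnW lt_j) lt_j); lia.
have := ham_h _ _ neq_x; have := detour_le_levels _ _ tree_e (x j) (x j.+1).
have : (h (x j) <= h (x j.+1))%N by apply: mono_h; lia.
lia.
Qed.

Lemma ordering_ends_levels_ge x :
  is_ordering x -> (1 < n)%N -> (zeta' e <= L (x 0) + L (x (n - 1)))%N.
Proof.
move=> ord_x n_gt1; apply: level_sum_ge => //.
by apply/eqP => /(ordering_inj _ _ ord_x); lia.
Qed.

Lemma span_ge_levels x h :
    hamiltonian_coloring e h -> is_ordering x -> nondecreasing_along T x h ->
  hc_bound - (zeta' e)%:Z + (L (x 0%N))%:Z + (L (x (n - 1)%N))%:Z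
    <= (coloring_span h)%:Z.
Proof.
move=> ham_h ord_x mono_h; rewrite (span_nondecreasing _ x) //.
have : (h (x 0%N) <= h (x (n - 1)%N))%N by apply: mono_h; lia.
have : tight_gap x 0 (n - 1) <= (h (x (n - 1)%N))%:Z - (h (x 0%N))%:Z.
  by apply: tight_gap_le => //; lia.
by rewrite tight_gap_total //; lia.
Qed.

Lemma hc_bound_le_span h :
  hamiltonian_coloring e h -> (1 < n)%N -> hc_bound <= (coloring_span h)%:Z.
Proof.
move=> ham_h n_gt1.
have [x ord_x mono_h] := exists_nondecreasing_ordering _ h T_gt0.
have := span_ge_levels x h ham_h ord_x mono_h.
by have := ordering_ends_levels_ge x ord_x n_gt1; lia.
Qed.

(** * Colorings that meet the bound *)

Lemma zeta'_card1 : #|weight_centers e| = 1%N -> zeta' e = 1%N.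
Proof. by rewrite /zeta' /zeta => ->. Qed.

Lemma zeta'_card2 : #|weight_centers e| = 2%N -> zeta' e = 0%N.
Proof. by rewrite /zeta' /zeta => ->. Qed.

(** Any excess of the end levels over [zeta'] would push the span above [hc_bound]. *)
Lemma tight_coloring_levels x h :
    hamiltonian_coloring e h -> is_ordering x -> nondecreasing_along T x h ->
    (1 < n)%N -> (coloring_span h)%:Z = hc_bound ->
  (L (x 0) + L (x (n - 1)) = zeta' e)%N.
Proof.
move=> ham_h ord_x mono_h n_gt1 span_h.
have := span_ge_levels x h ham_h ord_x mono_h.
by have := ordering_ends_levels_ge x ord_x n_gt1; lia.
Qed.

Lemma tight_coloring_good_ordering x h :
    hamiltonian_coloring e h -> is_ordering x -> nondecreasing_along T x h ->
    (1 < n)%N -> (coloring_span h)%:Z = hc_bound -> L (x 0%N) = 0%N ->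
  good_ordering e x.
Proof.
move=> ham_h ord_x mono_h n_gt1 span_h L0.
have LE := tight_coloring_levels x h ham_h ord_x mono_h n_gt1 span_h.
split=> // [|i j /andP[lt_ij lt_j]].
  by split=> [/zeta'_card1|/zeta'_card2]; lia.
have le_h : (h (x i) <= h (x j))%N by apply: mono_h; lia.
(* The positions [i] and [j] cut the ordering into three stretches. On each, the tight gap is at
   most the color difference, and both add up to the span, so all three are equalities. *)
have gapE : tight_gap x i j = (h (x j))%:Z - (h (x i))%:Z.
  have gap_le a b : (a <= b < n)%N -> tight_gap x a b <= (h (x b))%:Z - (h (x a))%:Z.
    exact: tight_gap_le.
  have le_in : (i <= n - 1)%N by lia.
  have le_jn : (j <= n - 1)%N by lia.
  have le_0n : (h (x 0%N) <= h (x (n - 1)%N))%N by apply: mono_h; lia.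
  have := tight_gap_total x ord_x.
  rewrite (tight_gapD x 0 i) // (tight_gapD x i j) ?(ltnW lt_ij) //.
  have := span_nondecreasing _ x ord_x h T_gt0 mono_h.
  have := gap_le 0%N i (leq_ltn_trans (ltnW lt_ij) lt_j).
  have : tight_gap x i j <= (h (x j))%:Z - (h (x i))%:Z by apply: gap_le; lia.
  have : tight_gap x j (n - 1) <= (h (x (n - 1)%N))%:Z - (h (x j))%:Z.
    by apply: gap_le; lia.
  move: (tight_gap x 0 i) (tight_gap x i j) (tight_gap x j _) => g1 g2 g3.
  clear -span_h le_0n LE; lia.
have neq_x : x i != x j.
  by apply/eqP => /(ordering_inj _ _ ord_x); lia.
(* The detour condition is the coloring inequality with the color difference replaced by the tight
   gap. *)
have := ham_h _ _ neq_x; move: gapE; rewrite /tight_gap; lia.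
Qed.

Lemma tight_coloring_exists_good_ordering h :
    hamiltonian_coloring e h -> (1 < n)%N -> (coloring_span h)%:Z = hc_bound ->
  exists x, good_ordering e x.
Proof.
move=> ham_h n_gt1 span_h.
have [x ord_x mono_h] := exists_nondecreasing_ordering _ h T_gt0.
have LE := tight_coloring_levels x h ham_h ord_x mono_h n_gt1 span_h.
have [L0 | LN0] := eqVneq (L (x 0%N)) 0%N.
  by exists x; apply: tight_coloring_good_ordering span_h L0.
(* The end levels add up to [zeta'], at most 1, so here the last vertex has level 0. Reversing the
   ordering and reflecting the colors puts it first; [M] is the largest color, so [M - h v] does not
   truncate. *)
pose y i := x (n - 1 - i)%N; pose M := h (x (n - 1)%N).
have le_M v : (h v <= M)%N.
  by have [i lt_i <-] := ordering_surj _ _ ord_x v; apply: mono_h; lia.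
have distE u v : `|(M - h u)%N - (M - h v)%N|%N = `|h u - h v|%N.
  by have := le_M u; have := le_M v; lia.
exists y; apply: (tight_coloring_good_ordering y (fun v => M - h v)%N) => //.
- by move=> u v uNv; rewrite distE; apply: ham_h.
- exact: is_ordering_rev.
- by move=> i j ij; apply: leq_sub2l; apply: mono_h; lia.
- rewrite -span_h; congr Posz; apply: eq_bigr => u _; apply: eq_bigr => v _.
  exact: distE.
by rewrite /y subn0; move: LE; rewrite /zeta'; lia.
Qed.

(** * The coloring induced by a good ordering *)

Section Induced.

Variable x : nat -> T.
Hypothesis good_x : good_ordering e x.

Lemma good_ordering_gap_ge i j : (i < j < n)%N ->
  n%:Z - 1 - (d (x i) (x j))%:Z <= tight_gap x i j.
Proof.
by case: good_x => _ _ det_x /det_x; rewrite /tight_gap; lia.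
Qed.

(** A detour is at most [n - 1], so the detour condition makes a single tight step nonnegative. This
    keeps the induced colors natural numbers. *)
Lemma good_ordering_step_ge i : (i.+1 < n)%N ->
  (zeta e + L (x i) + L (x i.+1) < n)%N.
Proof.
move=> lt_i; have := good_ordering_gap_ge i i.+1.
rewrite tight_gapS // tight_gap_refl.
by have := detour_lt_card _ e (x i) (x i.+1) T_gt0; lia.
Qed.

Lemma induced_coloring_exists : exists h, induced_coloring e x h.
Proof.
have [ord_x _ _] := good_x.
pose idx v := index v (mkseq x n).
have idxK i : (i < n)%N -> idx (x i) = i.
  move=> lt_i; rewrite /idx -{1}(nth_mkseq (x 0%N) x lt_i) index_uniq ?size_mkseq //.
  by rewrite (perm_uniq ord_x) enum_uniq.
(* The color of a vertex accumulates the tight steps before its position; the natural subtractions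
   are exact by [good_ordering_step_ge]. *)
exists (fun v => \sum_(0 <= t < idx v) (n - 1 - zeta e - L (x t) - L (x t.+1)))%N.
split=> [|i lt_i]; first by rewrite idxK // big_geq.
rewrite !idxK //; last exact: ltnW.
rewrite big_nat_recr // PoszD; have := good_ordering_step_ge i lt_i.
by move: (\sum_(_ <= _ < _) _)%N => S; lia.
Qed.

Variable h : T -> nat.
Hypothesis ind_h : induced_coloring e x h.

Lemma induced_coloring_gap i j : (i <= j < n)%N ->
  (h (x j))%:Z - (h (x i))%:Z = tight_gap x i j.
Proof.
case/andP; elim: j => [|j IHj] le_ij lt_j.
  by move: le_ij; rewrite leqn0 => /eqP->; rewrite tight_gap_refl; lia.
move: le_ij; rewrite leq_eqVlt => /predU1P[->|]; first by rewrite tight_gap_refl; lia.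
rewrite ltnS => le_ij; rewrite tight_gapS //.
have := IHj le_ij (ltnW lt_j); have := ind_h.2 j lt_j; lia.
Qed.

Lemma induced_coloring_ham : hamiltonian_coloring e h.
Proof.
have [ord_x _ _] := good_x.
have ham_lt i j : (i < j < n)%N ->
    (n - 1 <= d (x i) (x j) + `|h (x i) - h (x j)|)%N.
  move=> ij; have := good_ordering_gap_ge i j ij.
  by rewrite -induced_coloring_gap; lia.
move=> u v; have [i lt_i <-] := ordering_surj _ _ ord_x u.
have [j lt_j <-] := ordering_surj _ _ ord_x v.
have [lt_ij|lt_ji|->] := ltngtP i j; last by rewrite eqxx.
  by move=> _; apply: ham_lt; lia.
by move=> _; rewrite tree_detourC // distnC; apply: ham_lt; lia.
Qed.

Lemma induced_coloring_span : (1 < n)%N -> (coloring_span h)%:Z = hc_bound.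
Proof.
move=> n_gt1; have [ord_x end_x _] := good_x.
(* A tight gap is at least [n - 1] minus a detour, hence nonnegative. *)
have mono_h : nondecreasing_along T x h.
  move=> i j /andP[]; rewrite leq_eqVlt => /predU1P[-> //|lt_ij lt_j].
  have := good_ordering_gap_ge i j; rewrite -induced_coloring_gap; last by lia.
  have := detour_lt_card _ e (x i) (x j) T_gt0; lia.
rewrite (span_nondecreasing _ x) //.
have : (h (x 0%N) <= h (x (n - 1)%N))%N by apply: mono_h; lia.
have : (h (x (n - 1)%N))%:Z - (h (x 0%N))%:Z = tight_gap x 0 (n - 1).
  by apply: induced_coloring_gap; lia.
rewrite tight_gap_total //.
(* The end levels must cancel [zeta']. As there are one or two centers, one clause of the endpoint
   condition applies. *)
suff : (L (x 0) + L (x (n - 1)) = zeta' e)%N by lia.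
have := card_weight_centers_le2 _ _ tree_e.
have := weight_centers_neq0 _ e T_gt0; rewrite -card_gt0.
case: end_x => end1 end2; case W: #|_| => [|[|[|k]]] // _ _.
  by case: (end1 W) => -> ->; rewrite zeta'_card1.
by case: (end2 W) => -> ->; rewrite zeta'_card2.
Qed.

End Induced.

(** * Identifying [hc] with the bound *)

Lemma hc_attained : exists2 h, hamiltonian_coloring e h & coloring_span h = hc e.
Proof. by rewrite /hc; case: ex_minnP => k /boolp.asboolP. Qed.

Lemma hc_le_span h : hamiltonian_coloring e h -> (hc e <= coloring_span h)%N.
Proof.
rewrite /hc; case: ex_minnP => k _ min_k ham_h.
by apply: min_k; apply/boolp.asboolP; exists h.
Qed.

(** The minimum span lies between [hc_bound] and the span of [h], and these two coincide. *)
Lemma good_ordering_optimal x h : (1 < n)%N ->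
    good_ordering e x -> induced_coloring e x h ->
  optimal_coloring e h /\ (hc e)%:Z = hc_bound.
Proof.
move=> n_gt1 good_x ind_h.
have ham_h := induced_coloring_ham x good_x h ind_h.
have span_h := induced_coloring_span x good_x h ind_h n_gt1.
have [h' ham_h' span_h'] := hc_attained.
have := hc_bound_le_span h' ham_h' n_gt1; have := hc_le_span h ham_h.
rewrite span_h' -span_h => le1 le2.
have eq_span : coloring_span h = hc e by lia.
by rewrite -eq_span.
Qed.

End TreeColorings.

Local Open Scope ring_scope.

Theorem theorem2 (T : finType) (e : rel T)
    (tree_e : is_tree e) (n_ge4 : (4 <= #|T|)%N)
    (Delta_ge3 : (3 <= max_degree e)%N) :
  ((hc e)%:Z = (#|T|%:Z - 1) * (#|T|%:Z - 1 - (zeta e)%:Z) + (zeta' e)%:Z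
               - 2 * (total_level e)%:Z
   <-> exists x : nat -> T, good_ordering e x)
  /\
  (forall x : nat -> T, good_ordering e x ->
     (exists h : T -> nat, induced_coloring e x h) /\
     (forall h : T -> nat, induced_coloring e x h -> optimal_coloring e h)).
Proof.
have n_gt1 : (1 < #|T|)%N by apply: leq_trans n_ge4.
have n_gt0 := ltnW n_gt1.
rewrite -/(hc_bound T e); split; first split=> [hcE | [x good_x]].
- have [h ham_h span_h] := hc_attained _ e.
  by apply: (tight_coloring_exists_good_ordering _ e _ _ h); rewrite ?span_h.
(* The value of [hc] is read off from an induced coloring, so one is constructed first. *)
- have [h ind_h] := induced_coloring_exists _ e n_gt0 x good_x.
  by case: (good_ordering_optimal _ e tree_e n_gt0 x h).
move=> x good_x; split=> [|h ind_h]; first exact: induced_coloring_exists.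
by case: (good_ordering_optimal _ e tree_e n_gt0 x h).
Qed.
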